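(* Let $m\le n$ be positive integers, let $A\in\mathbb{R}^{n\times n}$ be symmetric positive definite, let $C\in\mathbb{R}^{m\times m}$ be symmetric positive semidefinite, and let $B\in\mathbb{R}^{m\times n}$ have full rank (i.e. rank $m$). Let $\beta>0$ be a real number and let $$\mathcal{A}=\begin{pmatrix}A & B^T\\ -B & C\end{pmatrix},\qquad \mathcal{P}_{RMGSS}=\begin{pmatrix}A & B^T\\ -B & \beta I+C\end{pmatrix}.$$ Then the matrix $\Psi=\mathcal{P}_{RMGSS}^{-1}\mathcal{A}$ has an eigenvalue $1$ with multiplicity $n$, and the remaining eigenvalues are $$\lambda_i=\frac{\mu_i}{\beta+\mu_i},\qquad 1\le i\le m,$$ where $\mu_1,\dots,\mu_m$ are the eigenvalues of the matrix $G=C+BA^{-1}B^T$.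
   Context: $I$ denotes the $m\times m$ identity matrix. The matrix $\mathcal{P}_{RMGSS}$ is nonsingular. The eigenvalues $\mu_1,\dots,\mu_m$ of the $m\times m$ matrix $G$ are listed with multiplicity. *)

(* Defs.v *)
From mathcomp Require Export all_boot all_order all_algebra.
From mathcomp Require Export reals.
From mathcomp.real_closed Require Export complex.

Set Implicit Arguments.
Unset Strict Implicit.
Unset Printing Implicit Defensive.

Import Order.TTheory GRing.Theory Num.Theory.
Local Open Scope ring_scope.

Definition spd_mx (R : realType) (k : nat) (M : 'M[R]_k) : Prop :=
  M \is symmetricmx /\ forall x : 'cV[R]_k, x != 0 -> 0 < (x^T *m M *m x) 0 0.

Definition spsd_mx (R : realType) (k : nat) (M : 'M[R]_k) : Prop :=
  M \is symmetricmx /\ forall x : 'cV[R]_k, 0 <= (x^T *m M *m x) 0 0.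

(* [s] lists the complex eigenvalues of the real matrix [M], each repeated
   according to its algebraic multiplicity; comparing degrees, [size s = k]. *)
Definition eigenvalue_list (R : realType) (k : nat) (M : 'M[R]_k)
    (s : seq R[i]) : Prop :=
  char_poly (map_mx (real_complex R) M) = \prod_(z <- s) ('X - z%:P).

Definition alg_mult (R : realType) (k : nat) (M : 'M[R]_k) (z : R[i]) : nat :=
  mup z (char_poly (map_mx (real_complex R) M)).

Section SaddlePoint.

Variables (R : realType) (m n : nat).
Variables (A : 'M[R]_n) (B : 'M[R]_(m, n)) (C : 'M[R]_m) (beta : R).

Definition saddle_mx : 'M[R]_(n + m) := block_mx A B^T (- B) C.

Definition P_RMGSS : 'M[R]_(n + m) := block_mx A B^T (- B) (beta%:M + C).

Definition Psi_mx : 'M[R]_(n + m) := invmx P_RMGSS *m saddle_mx.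

Definition G_mx : 'M[R]_m := C + B *m invmx A *m B^T.

End SaddlePoint.

(* Main.v *)
Require Import Defs.

Set Implicit Arguments.
Unset Strict Implicit.
Unset Printing Implicit Defensive.

Import Order.TTheory GRing.Theory Num.Theory.
Local Open Scope ring_scope.

(** Eliminating the block [- B] against [A] turns [z *: P - saddle_mx] into a
    block triangular matrix with diagonal blocks [(z - 1) *: A] and
    [z * beta + (z - 1) *: G], while [P] itself becomes block triangular with
    diagonal blocks [A] and [beta + G]. Hence, for every scalar [z],
    [det (z - Psi) = (z - 1)^n * det (z * beta + (z - 1) *: G) / det (beta + G)],
    and both determinants in [G] split over the eigenvalues of [G]. Nothing is
    divided by zero since [beta + G] is positive definite. *)

(** Schur complement with the pivot kept as a right factor of the lower-left block: nothing is
    inverted, so the formula survives a singular pivot such as [(z - 1) *: A] at [z = 1]. *)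
Lemma det_block_mulmx (R : comPzRingType) (n1 n2 : nat) (A : 'M[R]_n1)
    (D : 'M[R]_(n1, n2)) (K : 'M[R]_(n2, n1)) (F : 'M[R]_n2) :
  \det (block_mx A D (K *m A) F) = \det A * \det (F - K *m D).
Proof.
have -> : block_mx A D (K *m A) F =
    block_mx 1%:M 0 K 1%:M *m block_mx A D 0 (F - K *m D).
  by rewrite mulmx_block !mul1mx !mul0mx !addr0 addrC subrK.
by rewrite det_mulmx det_lblock det_ublock !det1 !mul1r.
Qed.

Lemma horner_char_poly (R : comNzRingType) (k : nat) (M : 'M[R]_k) (z : R) :
  (char_poly M).[z] = \det (z%:M - M).
Proof.
rewrite -horner_evalE -det_map_mx; congr (\det _).
apply/matrixP=> i j; rewrite !mxE /= /horner_eval.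
by rewrite hornerD hornerN hornerC hornerMn hornerX.
Qed.

(** For [b != 0], factoring out [b] leaves the characteristic polynomial at [a / b]. The case
    [b = 0] also occurs: the pencil in [G] has [b = 1 - z]. *)
Lemma det_pencil_split (F : fieldType) (k : nat) (M : 'M[F]_k)
    (mu : k.-tuple F) (a b : F) :
  char_poly M = \prod_(x <- mu) ('X - x%:P) ->
  \det (a%:M - b *: M) = \prod_(i < k) (a - b * tnth mu i).
Proof.
move=> chiM; have [->|b_neq0] := eqVneq b 0.
  rewrite scale0r subr0 det_scalar.
  by under eq_bigr => i _ do rewrite mul0r subr0; rewrite prodr_const card_ord.
have -> : a%:M - b *: M = b *: ((a / b)%:M - M).
  by rewrite scalerBr scale_scalar_mx mulrC divfK.
rewrite detZ -horner_char_poly chiM big_tuple horner_prod.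
rewrite -[k in b ^+ k]card_ord -prodr_const -big_split /=.
by apply: eq_bigr => i _; rewrite hornerXsubC mulrBr mulrC divfK.
Qed.

(** An algebraically closed field is infinite, so a nonzero difference would have a non-root. This
    allows characteristic polynomials to be compared pointwise. *)
Lemma closed_field_poly_ext (F : closedFieldType) (p q : {poly F}) :
  (forall z, p.[z] = q.[z]) -> p = q.
Proof.
move=> eq_pq; apply/eqP; rewrite -subr_eq0; apply/negPn/negP.
by case/closed_nonrootP=> z; rewrite rootE hornerD hornerN eq_pq subrr eqxx.
Qed.

Lemma posdef_unitmx (R : realFieldType) (k : nat) (M : 'M[R]_k) :
  (forall x : 'cV[R]_k, x != 0 -> 0 < (x^T *m M *m x) 0 0) -> M \in unitmx.
Proof.
move=> M_pos; rewrite -row_free_unit; apply: inj_row_free => v vM0.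
apply/eqP/negPn/negP => v_neq0; have := M_pos v^T.
by rewrite trmxK vM0 mul0mx mxE ltxx trmx_eq0 => /(_ v_neq0).
Qed.

Lemma spd_unitmx (R : realType) (k : nat) (M : 'M[R]_k) :
  spd_mx M -> M \in unitmx.
Proof. by case=> _; apply: posdef_unitmx. Qed.

Lemma shifted_G_unitmx (R : realType) (m n : nat) (A : 'M[R]_n)
    (B : 'M[R]_(m, n)) (C : 'M[R]_m) (beta : R) :
  spd_mx A -> spsd_mx C -> 0 < beta -> beta%:M + G_mx A B C \in unitmx.
Proof.
move=> A_spd [_ C_ge0] beta_gt0; have [_ A_pos] := A_spd.
have A_unit := spd_unitmx A_spd.
apply: posdef_unitmx => x x_neq0.
rewrite /G_mx !mulmxDr !mulmxDl mxE [X in _ + X]mxE.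
have quadG_ge0 : 0 <= (x^T *m (B *m invmx A *m B^T) *m x) 0 0.
  (* Since [A y = B^T x], the form [y^T A y] equals [y^T B^T x], whose transpose is [x^T B y]. *)
  set y := invmx A *m (B^T *m x).
  have -> : x^T *m (B *m invmx A *m B^T) *m x = (y^T *m A *m y)^T.
    rewrite -(mulmxA y^T) /y mulKVmx // trmx_mul trmxK trmx_mul trmxK.
    by rewrite !mulmxA.
  rewrite [leRHS]mxE; have [->|y_neq0] := eqVneq y 0.
    by rewrite mulmx0 mxE.
  by apply: ltW; apply: A_pos.
(* Strictness comes from the term [beta * |x|^2]. *)
rewrite ltr_pwDl ?addr_ge0 //.
rewrite mul_mx_scalar -scalemxAl mxE mulr_gt0 //.
rewrite mxE lt0r sumr_ge0; last by move=> i _; rewrite mxE -expr2 sqr_ge0.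
rewrite andbT psumr_eq0; last by move=> i _; rewrite mxE -expr2 sqr_ge0.
apply: contra x_neq0 => /allP x0; apply/eqP/matrixP=> i j; rewrite ord1 !mxE.
by have := x0 i (mem_index_enum _); rewrite mxE -expr2 sqrf_eq0 => /eqP.
Qed.

Lemma det_P_RMGSS (R : realType) (m n : nat) (A : 'M[R]_n)
    (B : 'M[R]_(m, n)) (C : 'M[R]_m) (beta : R) : A \in unitmx ->
  \det (P_RMGSS A B C beta) = \det A * \det (beta%:M + G_mx A B C).
Proof.
move=> A_unit; rewrite /P_RMGSS -[- B](mulmxKV A_unit) det_block_mulmx.
by rewrite mulNmx mulNmx opprK addrA.
Qed.

Lemma det_saddle_pencil (R : realType) (m n : nat) (A : 'M[R]_n)
    (B : 'M[R]_(m, n)) (C : 'M[R]_m) (beta : R) (z : R[i]) : A \in unitmx ->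
  let toC k l := @map_mx _ _ (real_complex R) k l in
  \det (z *: toC _ _ (P_RMGSS A B C beta) - toC _ _ (saddle_mx A B C)) =
    (z - 1) ^+ n * \det (toC _ _ A)
    * \det ((z * real_complex R beta)%:M - (1 - z) *: toC _ _ (G_mx A B C)).
Proof.
move=> A_unit toC.
(* The lower-left block [(1 - z) B] is [- B A^-1] times the pivot [(z - 1) A], with a multiplier
   independent of [z]. *)
have -> : z *: toC _ _ (P_RMGSS A B C beta) - toC _ _ (saddle_mx A B C) =
    block_mx ((z - 1) *: toC _ _ A) ((z - 1) *: toC _ _ B^T)
      (toC _ _ (- (B *m invmx A)) *m ((z - 1) *: toC _ _ A))
      ((z * real_complex R beta)%:M - (1 - z) *: toC _ _ C).
  rewrite /toC !map_block_mx scale_block_mx opp_block_mx add_block_mx.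
  rewrite -scalemxAr -map_mxM mulNmx mulmxKV // map_mxD map_scalar_mx.
  rewrite scalerDr scale_scalar_mx !scalerBl !scale1r opprB.
  by rewrite addrA.
rewrite det_block_mulmx detZ; congr (_ * \det _).
rewrite /G_mx /toC map_mxD map_mxN mulNmx opprK -scalemxAr -map_mxM scalerDr.
by rewrite opprD addrA -(opprB 1 z) scaleNr.
Qed.

Theorem theorem2 (R : realType) (m n : nat)
    (A : 'M[R]_n) (B : 'M[R]_(m, n)) (C : 'M[R]_m) (beta : R)
    (mu : m.-tuple R[i])
    (m_gt0 : (0 < m)%N) (le_mn : (m <= n)%N)
    (A_spd : spd_mx A) (C_spsd : spsd_mx C) (B_rank : \rank B = m)
    (beta_gt0 : 0 < beta)
    (mu_eig : eigenvalue_list (G_mx A B C) mu) :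
  [/\ P_RMGSS A B C beta \in unitmx,
      forall i : 'I_m, real_complex R beta + tnth mu i != 0,
      alg_mult (Psi_mx A B C beta) 1 = n &
      eigenvalue_list (Psi_mx A B C beta)
        (nseq n 1 ++
         [seq tnth mu i / (real_complex R beta + tnth mu i) | i : 'I_m])].
Proof.
have A_unit := spd_unitmx A_spd.
have bG_unit := shifted_G_unitmx B A_spd C_spsd beta_gt0.
have P_unit : P_RMGSS A B C beta \in unitmx.
  by rewrite unitmxE det_P_RMGSS // unitrM -!unitmxE A_unit.
set b := real_complex R beta.
have b_neq0 : b != 0 by rewrite fmorph_eq0 gt_eqF.
have det_bG : real_complex R (\det (beta%:M + G_mx A B C)) =
    \prod_(i < m) (b + tnth mu i).
  rewrite -det_map_mx map_mxD map_scalar_mx /=.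
  have := det_pencil_split b (-1) mu_eig; rewrite scaleN1r opprK => ->.
  by apply: eq_bigr => i _; rewrite mulN1r opprK.
(* The product of these complex numbers is the determinant of the invertible [beta + G], so no
   factor vanishes. *)
have bmu_neq0 i : b + tnth mu i != 0.
  have : \prod_(i < m) (b + tnth mu i) != 0.
    by rewrite -det_bG fmorph_eq0 -unitfE -unitmxE.
  by move/prodf_neq0; apply.
have Psi_eig : eigenvalue_list (Psi_mx A B C beta)
    (nseq n 1 ++ [seq tnth mu i / (b + tnth mu i) | i : 'I_m]).
  apply: closed_field_poly_ext => z; rewrite horner_char_poly.
  have detP_neq0 : \det (map_mx (real_complex R) (P_RMGSS A B C beta)) != 0.
    by rewrite det_map_mx fmorph_eq0 -unitfE -unitmxE.
  (* Multiplying by [det P] turns [z - Psi] into the pencil [z P - saddle_mx]. *)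
  apply: (mulfI detP_neq0); rewrite -det_mulmx mulmxBr mul_mx_scalar -map_mxM.
  rewrite mulKVmx // det_saddle_pencil // (det_pencil_split _ _ mu_eig).
  rewrite !det_map_mx det_P_RMGSS // rmorphM /= det_bG.
  rewrite big_cat big_nseq /= big_image /= hornerM horner_prod.
  rewrite iter_mulr_1 horner_exp hornerXsubC.
  rewrite mulrACA [X in _ = X * _]mulrC; congr (_ * _).
  (* Factor by factor, [z b - (1 - z) mu_i = (b + mu_i) (z - mu_i / (b + mu_i))]. *)
  rewrite -big_split; apply: eq_bigr => i _ /=.
  rewrite hornerXsubC mulrBr mulrCA divff // mulr1.
  by rewrite -/b mulrBl mul1r mulrDl opprB addrA ![_ * z]mulrC.
split=> //.
rewrite /alg_mult Psi_eig mu_prod_XsubC count_cat count_nseq /= eqxx mul1n.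
(* The multiplicity is exactly [n]: [mu_i / (b + mu_i) - 1 = - b / (b + mu_i)] is nonzero, so no
   other listed eigenvalue is 1. *)
rewrite [X in (_ + X)%N](_ : _ = 0%N) ?addn0 //.
apply/eqP; rewrite -leqn0 leqNgt -has_count.
apply/hasPn => _ /mapP [i _ ->] /=.
rewrite -subr_eq0 -[1](divff (bmu_neq0 i)) -mulrBl opprD addrC subrK.
by rewrite mulf_neq0 ?oppr_eq0 ?invr_eq0.
Qed.
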